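(* Let $m,n$ be positive integers, $Q=(q_{ij})$ a real $m\times n$ matrix, $c\in\mathbb{R}^m$ and $d\in\mathbb{R}^n$ row vectors, and let $\mathcal{A}(Q,c,d)$ be the average objective function value over all $2^{m+n}$ solutions of the bipartite boolean quadratic programming problem with data $(Q,c,d)$. Then $$\mathcal{A}(Q,c,d)=\frac14\sum_{i=1}^m\sum_{j=1}^n q_{ij}+\frac12\sum_{i=1}^m c_i+\frac12\sum_{j=1}^n d_j .$$
   Context: The bipartite boolean quadratic programming problem (BBQP) with data $(Q,c,d)$ is to maximize $f(x,y)=x^TQy+cx+dy$ subject to $x\in\{0,1\}^m$, $y\in\{0,1\}^n$. The set of all solutions is $\mathcal{F}=\{0,1\}^m\times\{0,1\}^n$, so $|\mathcal{F}|=2^{m+n}$, and $\mathcal{A}(Q,c,d)=2^{-(m+n)}\sum_{(x,y)\in\mathcal{F}}f(x,y)$. *)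

(* Defs.v *)
From mathcomp Require Import all_boot all_order all_algebra.
From mathcomp Require Import reals.

Set Implicit Arguments.
Unset Strict Implicit.
Unset Printing Implicit Defensive.

Import Order.TTheory GRing.Theory Num.Theory.
Local Open Scope ring_scope.

(* The finite type {0,1}^m x {0,1}^n: 0/1 column vectors are encoded as boolean
   matrices, so that one can sum over them. *)
Definition solution (m n : nat) : finType := ('cV[bool]_m * 'cV[bool]_n)%type.

Lemma card_solution (m n : nat) : #|solution m n| = (2 ^ (m + n))%N.
Proof. by rewrite card_prod !card_mx card_bool !muln1 expnD. Qed.

Definition real01 (R : realType) (k : nat) (x : 'cV[bool]_k) : 'cV[R]_k :=
  map_mx (fun b : bool => b%:R) x.

(* x^T Q y + c x + d y is a 1 x 1 matrix; the value is its only entry. *)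
Definition objective (R : realType) (m n : nat) (Q : 'M[R]_(m, n))
    (c : 'rV[R]_m) (d : 'rV[R]_n) (s : solution m n) : R :=
  let x := real01 R s.1 in
  let y := real01 R s.2 in
  (x^T *m Q *m y + c *m x + d *m y) 0 0.

Definition average_value (R : realType) (m n : nat) (Q : 'M[R]_(m, n))
    (c : 'rV[R]_m) (d : 'rV[R]_n) : R :=
  2 ^- (m + n) * \sum_(s : solution m n) objective Q c d s.

(* Main.v *)
Require Import Defs.
From mathcomp Require Import all_boot all_order all_algebra.
From mathcomp Require Import reals.
From mathcomp Require Import ring.

Set Implicit Arguments.
Unset Strict Implicit.
Unset Printing Implicit Defensive.

Import Order.TTheory GRing.Theory Num.Theory.
Local Open Scope ring_scope.

(** The objective is affine in x for fixed y and affine in y for fixed x, and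
    the solution set is a product, so averaging over it amounts to replacing x
    and y by their separate averages ([sum_objective]).  Complementing every
    bit is an involution of the cube that pairs each vector with one whose sum
    with it is the all-ones vector, hence the average point of a cube is
    (1/2, ..., 1/2) ([sum_real01]).  The average value is therefore the value
    of the objective at that centre: a factor 1/2 * 1/2 on the entries of Q,
    and a factor 1/2 on those of c and d. *)

Lemma sum_real01 (R : realType) (k : nat) :
  \sum_(x : 'cV[bool]_k) real01 R x = const_mx (2 ^+ k / 2).
Proof.
have flipK : involutive (@map_mx _ _ negb k 1).
  by move=> x; apply/matrixP => i j; rewrite !mxE negbK.
have flipD (x : 'cV[bool]_k) :
    real01 R x + real01 R (map_mx negb x) = const_mx 1.
  by apply/matrixP => i j; rewrite !mxE; case: (x i j); rewrite ?addr0 ?add0r.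
set S := \sum_x _.
have S2 : S + S = const_mx (2 ^+ k).
  rewrite {2}/S (reindex_inj (inv_inj flipK)) /= -big_split /=.
  rewrite (eq_bigr _ (fun x _ => flipD x)) sumr_const card_mx card_bool muln1.
  by apply/matrixP => i j; rewrite mulmxnE !mxE natrX.
apply/matrixP => i j; move/matrixP/(_ i j): S2; rewrite !mxE => <-.
by field.
Qed.

(** The weights are the numbers of vectors y completing a given x, and of
    vectors x completing a given y. *)
Lemma sum_objective (R : realType) (m n : nat) (Q : 'M[R]_(m, n))
    (c : 'rV[R]_m) (d : 'rV[R]_n)
    (X := \sum_(x : 'cV[bool]_m) real01 R x)
    (Y := \sum_(y : 'cV[bool]_n) real01 R y) :
  \sum_(s : solution m n) objective Q c d s =
    (X^T *m Q *m Y) 0 0 + 2 ^+ n * (c *m X) 0 0 + 2 ^+ m * (d *m Y) 0 0.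
Proof.
rewrite /objective -summxE.
rewrite -(pair_bigA _ (fun (x : 'cV[bool]_m) (y : 'cV[bool]_n) =>
  (real01 R x)^T *m Q *m real01 R y + c *m real01 R x + d *m real01 R y)) /=.
have inner (x : 'cV[bool]_m) :
    \sum_y ((real01 R x)^T *m Q *m real01 R y + c *m real01 R x
            + d *m real01 R y)
    = (real01 R x)^T *m Q *m Y + 2 ^+ n *: (c *m real01 R x) + d *m Y.
  rewrite !big_split /= sumr_const card_mx card_bool muln1 -!mulmx_sumr.
  by rewrite -scaler_nat natrX.
rewrite (eq_bigr _ (fun x _ => inner x)) !big_split /= sumr_const.
rewrite card_mx card_bool muln1 -!mulmx_suml -scaler_sumr -mulmx_sumr.
by rewrite -(scaler_nat _ (d *m Y)) natrX -raddf_sum !mxE.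
Qed.

Lemma mulmx_const_col (R : comNzRingType) (p q : nat) (A : 'M[R]_(p, q)) (a : R)
    (i : 'I_p) (j : 'I_1) :
  (A *m const_mx a) i j = a * \sum_k A i k.
Proof. by rewrite mxE mulr_sumr; apply: eq_bigr => k _; rewrite mxE mulrC. Qed.

Lemma bilinear_const (R : comNzRingType) (p q : nat) (A : 'M[R]_(p, q))
    (a b : R) (i j : 'I_1) :
  ((const_mx a : 'cV_p)^T *m A *m const_mx b) i j
  = a * b * \sum_k \sum_l A k l.
Proof.
rewrite mulmx_const_col exchange_big /= (mulrC a) -mulrA; congr (_ * _).
rewrite mulr_sumr; apply: eq_bigr => l _.
by rewrite mxE mulr_sumr; apply: eq_bigr => k _; rewrite !mxE.
Qed.

Theorem theorem1 (R : realType) (m n : nat) (hm : (0 < m)%N) (hn : (0 < n)%N)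
    (Q : 'M[R]_(m, n)) (c : 'rV[R]_m) (d : 'rV[R]_n) :
  average_value Q c d =
    1 / 4 * (\sum_(i < m) \sum_(j < n) Q i j)
    + 1 / 2 * (\sum_(i < m) c 0 i)
    + 1 / 2 * (\sum_(j < n) d 0 j).
Proof.
rewrite /average_value sum_objective !sum_real01.
rewrite bilinear_const !mulmx_const_col.
have m2 : 2 ^+ m != 0 :> R by rewrite expf_neq0 ?pnatr_eq0.
have n2 : 2 ^+ n != 0 :> R by rewrite expf_neq0 ?pnatr_eq0.
by rewrite exprD; field; rewrite m2 n2.
Qed.
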